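(* Let $R$ be a ring, let $(\mathcal{L},\mathcal{A})$ be a complete duality pair over $R$, let $\mathcal{P}$ be the class of projective left $R$-modules and let $\mathcal{GP}$ be the class of Gorenstein $(\mathcal{L},\mathcal{A})$-projective left $R$-modules. The following conditions are equivalent for a left $R$-module $M$. (1) $M$ is a Gorenstein $(\mathcal{L},\mathcal{A})$-projective module. (2) There exists a $\mathrm{Hom}_R(-,\mathcal{L})$-exact exact sequence $0\to M\to P_{-1}\to P_{-2}\to P_{-3}\to\cdots$ with each $P_i\in\mathcal{P}$, and $\mathrm{Ext}^i_R(M,L)=0$ for any $L\in\mathcal{L}$ and $i\geq 1$. (3) There exists an exact sequence $0\to M\to P\to G\to 0$ with $P\in\mathcal{P}$ and $G\in\mathcal{GP}$. (4) There exists an exact sequence $0\to G_1\to G_0\to M\to 0$ with $G_1,G_0\in\mathcal{GP}$, and $\mathrm{Ext}^1_R(M,L)=0$ for any $L\in\mathcal{L}$. (5) There exists a $\mathrm{Hom}_R(-,\mathcal{L})$-exact exact sequence $0\to M\to G_{-1}\to G_{-2}\to G_{-3}\to\cdots$ with each $G_i\in\mathcal{GP}$, and $\mathrm{Ext}^i_R(M,L)=0$ for any $L\in\mathcal{L}$ and $i\geq 1$. (6) There exists a $\mathrm{Hom}_R(-,\mathcal{L})$-exact exact sequence $\cdots\to G_1\to G_0\to G_{-1}\to G_{-2}\to\cdots$ with each $G_i\in\mathcal{GP}$ such that $M\cong\mathrm{Ker}(G_{-1}\to G_{-2})$. (7) There exists some class $\mathcal{U}$ of left $R$-modules with $\mathcal{P}\subseteq\mathcal{U}\subseteq\mathcal{GP}$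 and there exists a $\mathrm{Hom}_R(-,\mathcal{L})$-exact exact sequence $0\to M\to U_{-1}\to U_{-2}\to U_{-3}\to\cdots$ with each $U_i\in\mathcal{U}$, and $\mathrm{Ext}^i_R(M,L)=0$ for any $L\in\mathcal{L}$ and $i\geq 1$. (8) There exists some class $\mathcal{U}$ of left $R$-modules with $\mathcal{P}\subseteq\mathcal{U}\subseteq\mathcal{GP}$ and there exists a $\mathrm{Hom}_R(-,\mathcal{L})$-exact exact sequence $\cdots\to U_1\to U_0\to U_{-1}\to U_{-2}\to\cdots$ with each $U_i\in\mathcal{U}$ such that $M\cong\mathrm{Ker}(U_{-1}\to U_{-2})$.
   Context: $R$ is an associative ring with identity; modules are left $R$-modules unless stated otherwise. For a module $M$, $M^+=\mathrm{Hom}_{\mathbb{Z}}(M,\mathbb{Q}/\mathbb{Z})$ is its character module (on the opposite side). Duality pairs: a duality pair over $R$ is a pair $(\mathcal{L},\mathcal{A})$, with $\mathcal{L}$ a class of left (resp. right) $R$-modules and $\mathcal{A}$ a class of right (resp. left) $R$-modules, such that $L\in\mathcal{L}$ if and only if $L^+\in\mathcal{A}$, and $\mathcal{A}$ is closed under direct summands and finite direct sums. With $\mathcal{L}$ a class of left modules, $(\mathcal{L},\mathcal{A})$ is perfect if $\mathcal{L}$ contains ${}_RR$ and is closed under coproducts and extensions. $(\mathcal{L},\mathcal{A})$ is complete if it is a perfect duality pair and $(\mathcal{A},\mathcal{L})$ is also a duality pair. Classes of modules are closed under isomorphism. Here $\mathcal{L}$ consists of left modules and $\mathcal{A}$ of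 right modules. A sequence is $\mathrm{Hom}_R(-,\mathcal{L})$-exact if it remains exact after applying $\mathrm{Hom}_R(-,L)$ for every $L\in\mathcal{L}$. A left $R$-module $M$ is Gorenstein $(\mathcal{L},\mathcal{A})$-projective if there is a $\mathrm{Hom}_R(-,\mathcal{L})$-exact exact sequence $\cdots\to P_1\to P_0\to P_{-1}\to P_{-2}\to\cdots$ with each $P_i$ projective such that $M\cong\mathrm{Ker}(P_{-1}\to P_{-2})$. *)

(* Defs.v *)
From HB Require Import structures.
From mathcomp Require Import all_boot all_order all_algebra.
From mathcomp Require Import boolp functions.

Set Implicit Arguments.
Unset Strict Implicit.
Unset Printing Implicit Defensive.

Import GRing.Theory.

Local Open Scope ring_scope.

(* Conventions.  R ranges over pzRingType (the zero ring is allowed).  A left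
   R-module is an lmodType R; a right R-module is an lmodType R^c, where
   r *: x stands for x r.  Equality of linear maps is always stated
   pointwise. *)

Definition module_class (R : pzRingType) := lmodType R -> Prop.

Definition rat_int : zmodClosed rat :=
  GRing.ZmodClosed.clone rat (@Num.int_num_subdef rat) _.

Definition QmodZ : zmodType := {ideal_quot rat_int}.

Definition character (V : zmodType) := {additive V -> QmodZ}.

HB.instance Definition _ (V : zmodType) := gen_eqMixin (character V).
HB.instance Definition _ (V : zmodType) := gen_choiceMixin (character V).

Lemma character_ext (V : zmodType) (f g : character V) : f =1 g -> f = g.
Proof.
case: f g => [f [[Hf]]] [g [[Hg]]] /= /funext fg.
move: Hf Hg; rewrite fg => Hf Hg.
by rewrite (Prop_irrelevance Hf Hg).
Qed.

Section CharacterZmod.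
Variable V : zmodType.
Implicit Types f g h : character V.

Definition character_zero : character V := \0.
Definition character_add f g : character V := f \+ g.
Definition character_opp f : character V := \- f.

Let addA : associative character_add.
Proof. by move=> f g h; apply: character_ext => x /=; rewrite addrA. Qed.
Let addC : commutative character_add.
Proof. by move=> f g; apply: character_ext => x /=; rewrite addrC. Qed.
Let add0 : left_id character_zero character_add.
Proof. by move=> f; apply: character_ext => x /=; rewrite add0r. Qed.
Let addN : left_inverse character_zero character_opp character_add.
Proof. by move=> f; apply: character_ext => x /=; rewrite addNr. Qed.

HB.instance Definition _ :=
  GRing.isZmodule.Build (character V) addA addC add0 addN.
End CharacterZmod.

Definition character_scale (S : pzRingType) (M : lmodType S) (r : S)
  (f : character M) : character M := f \o *:%R r.

(* The character module of a left module is a right one, (f r)(x) = f (r x);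
   that of a right module is a left one, (r f)(x) = f (x r).  The two are
   separate definitions because R^c^c and R are not convertible. *)

Definition lchar (R : pzRingType) (M : lmodType R) := character M.
HB.instance Definition _ (R : pzRingType) (M : lmodType R) :=
  GRing.Zmodule.on (lchar M).

Definition rchar (R : pzRingType) (M : lmodType R^c) := character M.
HB.instance Definition _ (R : pzRingType) (M : lmodType R^c) :=
  GRing.Zmodule.on (rchar M).

Section LeftCharacterModule.
Variables (R : pzRingType) (M : lmodType R).

Definition lchar_scale (r : R^c) (f : lchar M) : lchar M :=
  character_scale (r : R) f.

Let scaleA (a b : R^c) (f : lchar M) :
  lchar_scale a (lchar_scale b f) = lchar_scale (a * b) f.
Proof. by apply: character_ext => x /=; rewrite scalerA. Qed.
Let scale1 : left_id 1 lchar_scale.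
Proof. by move=> f; apply: character_ext => x /=; rewrite scale1r. Qed.
Let scaleDr : right_distributive lchar_scale +%R.
Proof. by move=> a f g; apply: character_ext. Qed.
Let scaleDl (f : lchar M) : {morph lchar_scale^~ f : a b / a + b}.
Proof.
by move=> a b; apply: character_ext => x /=; rewrite scalerDl raddfD.
Qed.

HB.instance Definition _ := GRing.Zmodule_isLmodule.Build R^c (lchar M)
  scaleA scale1 scaleDr scaleDl.
End LeftCharacterModule.

Section RightCharacterModule.
Variables (R : pzRingType) (M : lmodType R^c).

Definition rchar_scale (r : R) (f : rchar M) : rchar M :=
  character_scale (r : R^c) f.

Let scaleA (a b : R) (f : rchar M) :
  rchar_scale a (rchar_scale b f) = rchar_scale (a * b) f.
Proof. by apply: character_ext => x /=; rewrite scalerA. Qed.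
Let scale1 : left_id 1 rchar_scale.
Proof. by move=> f; apply: character_ext => x /=; rewrite scale1r. Qed.
Let scaleDr : right_distributive rchar_scale +%R.
Proof. by move=> a f g; apply: character_ext. Qed.
Let scaleDl (f : rchar M) : {morph rchar_scale^~ f : a b / a + b}.
Proof.
by move=> a b; apply: character_ext => x /=; rewrite scalerDl raddfD.
Qed.

HB.instance Definition _ := GRing.Zmodule_isLmodule.Build R (rchar M)
  scaleA scale1 scaleDr scaleDl.
End RightCharacterModule.

Definition left_dual (R : pzRingType) (M : lmodType R) : lmodType R^c :=
  lchar M.
Definition right_dual (R : pzRingType) (M : lmodType R^c) : lmodType R :=
  rchar M.

Section Kernel.
Variables (R : pzRingType) (A B : lmodType R) (f : {linear A -> B}).

Definition ker_pred : pred A := fun x => f x == 0.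

Fact ker_pred_submod_closed : submod_closed ker_pred.
Proof.
split=> [|a x y]; first by rewrite unfold_in raddf0.
rewrite !unfold_in => /eqP fx /eqP fy.
by rewrite linearP fx fy scaler0 addr0.
Qed.
HB.instance Definition _ :=
  GRing.isSubmodClosed.Build R A ker_pred ker_pred_submod_closed.

Record kernel := Kernel { kernel_val :> A; _ : kernel_val \in ker_pred }.
HB.instance Definition _ := [isSub for kernel_val].
HB.instance Definition _ := [Choice of kernel by <:].
HB.instance Definition _ := [SubChoice_isSubLmodule of kernel by <:].
End Kernel.

Section ModuleNotions.
Variable R : pzRingType.
Implicit Types A B C M N P X : lmodType R.

Definition surjective_map A B (f : {linear A -> B}) := forall y, exists x, f x = y.

Definition exact A B C (f : {linear A -> B}) (g : {linear B -> C}) :=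
  forall y, g y = 0 <-> exists x, f x = y.

Definition short_exact A B C (f : {linear A -> B}) (g : {linear B -> C}) :=
  [/\ injective f, exact f g & surjective_map g].

(* Exactness of Hom(C,X) -> Hom(B,X) -> Hom(A,X) at Hom(B,X). *)
Definition hom_exact A B C (f : {linear A -> B}) (g : {linear B -> C}) X :=
  forall h : {linear B -> X},
    (forall x, h (f x) = 0) <-> exists k : {linear C -> X}, forall y, k (g y) = h y.

(* Surjectivity of Hom(B,X) -> Hom(A,X). *)
Definition hom_surjective A B (f : {linear A -> B}) X :=
  forall h : {linear A -> X}, exists k : {linear B -> X}, forall x, k (f x) = h x.

Definition isomorphic M N := exists f : {linear M -> N}, bijective f.

Definition projective P :=
  forall A B (g : {linear A -> B}) (f : {linear P -> B}), surjective_map g ->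
    exists h : {linear P -> A}, forall x, g (h x) = f x.

Definition coproduct_of (I : Type) (M : I -> lmodType R) C
    (inj : forall i, {linear M i -> C}) :=
  forall N (f : forall i, {linear M i -> N}),
    (exists h : {linear C -> N}, forall i x, h (inj i x) = f i x) /\
    (forall h h' : {linear C -> N}, (forall i x, h (inj i x) = f i x) ->
       (forall i x, h' (inj i x) = f i x) -> h =1 h').

Definition direct_summand B A := exists C, isomorphic A (B * C)%type.

Implicit Type K : module_class R.

Definition iso_closed K := forall M N, isomorphic M N -> K M -> K N.

Definition summand_closed K := forall A B, direct_summand B A -> K A -> K B.

Definition finite_sum_closed K :=
  forall n (M : 'I_n -> lmodType R) C (inj : forall i, {linear M i -> C}),
    coproduct_of inj -> (forall i, K (M i)) -> K C.

Definition coproduct_closed K :=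
  forall (I : Type) (M : I -> lmodType R) C (inj : forall i, {linear M i -> C}),
    coproduct_of inj -> (forall i, K (M i)) -> K C.

Definition extension_closed K :=
  forall A B C (f : {linear A -> B}) (g : {linear B -> C}),
    short_exact f g -> K A -> K C -> K B.

Definition projective_resolution M (P : nat -> lmodType R)
    (d : forall n, {linear P n.+1 -> P n}) (e : {linear P 0%N -> M}) :=
  [/\ forall n, projective (P n), surjective_map e, exact (d 0%N) e
    & forall n, exact (d n.+1) (d n)].

Definition cocycle (P : nat -> lmodType R)
    (d : forall n, {linear P n.+1 -> P n}) X i (c : {linear P i -> X}) :=
  forall x, c (d i x) = 0.

Definition coboundary (P : nat -> lmodType R)
    (d : forall n, {linear P n.+1 -> P n}) X i : {linear P i -> X} -> Prop :=
  match i with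
  | 0%N => fun c => forall x, c x = 0
  | j.+1 => fun c => exists b : {linear P j -> X}, forall x, c x = b (d j x)
  end.

(* Ext^i(M,X) = 0: the i-th cohomology of Hom(P,X) is zero, P a projective
   resolution of M.  The choice of P is immaterial, and P exists by
   projective_resolution_exists below. *)
Definition Ext_eq0 i M X :=
  forall (P : nat -> lmodType R) (d : forall n, {linear P n.+1 -> P n})
    (e : {linear P 0%N -> M}), projective_resolution d e ->
    forall c : {linear P i -> X}, cocycle d c -> coboundary d c.

Variable L : module_class R.

(* M is Ker(G_{-1} -> G_{-2}) in a Hom(-,L)-exact exact sequence
   ... -> G_1 -> G_0 -> G_{-1} -> G_{-2} -> ... with terms in K. *)
Definition complete_resolution K M :=
  exists (G : int -> lmodType R) (d : forall i, {linear G i -> G (i - 1)}),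
    [/\ forall i, K (G i),
        forall i, exact (d i) (d (i - 1)),
        forall X, L X -> forall i, hom_exact (d i) (d (i - 1)) X
      & isomorphic M (kernel (d (-1)))].

(* A Hom(-,L)-exact exact sequence 0 -> M -> G_{-1} -> G_{-2} -> ... with
   terms in K; G n stands for G_{-(n+1)}. *)
Definition coresolution K M :=
  exists (G : nat -> lmodType R) (e : {linear M -> G 0%N})
      (d : forall n, {linear G n -> G n.+1}),
    [/\ forall n, K (G n),
        [/\ injective e, exact e (d 0%N) & forall n, exact (d n) (d n.+1)]
      & forall X, L X -> [/\ hom_surjective e X, hom_exact e (d 0%N) X
                           & forall n, hom_exact (d n) (d n.+1) X]].

(* Gorenstein (L,A)-projectivity; only L enters the definition. *)
Definition gorenstein_projective M := complete_resolution projective M.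

End ModuleNotions.

Definition duality_pair (S T : pzRingType) (dual : lmodType S -> lmodType T)
    (L : module_class S) (A : module_class T) :=
  [/\ iso_closed L /\ iso_closed A, forall M, L M <-> A (dual M),
      summand_closed A & finite_sum_closed A].

Definition perfect_duality_pair (R : pzRingType)
    (L : module_class R) (A : module_class R^c) :=
  [/\ duality_pair (@left_dual R) L A, L R^o, coproduct_closed L
    & extension_closed L].

Definition complete_duality_pair (R : pzRingType)
    (L : module_class R) (A : module_class R^c) :=
  perfect_duality_pair L A /\ duality_pair (@right_dual R) A L.
Section FreeModule.
Variables (R : pzRingType) (I : choiceType).

Definition fin_supp : pred (I -> R^o) :=
  fun f => `[< exists s : seq I, forall i, i \notin s -> f i = 0 >].

Fact fin_supp_submod_closed : submod_closed fin_supp.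
Proof.
split=> [|a f g]; rewrite !unfold_in; first by apply/asboolP; exists [::].
move=> /asboolP[s fs] /asboolP[t gt]; apply/asboolP; exists (s ++ t) => i.
rewrite mem_cat negb_or => /andP[si ti].
by rewrite addrfctE scalrfctE (fs _ si) (gt _ ti) scaler0 addr0.
Qed.
HB.instance Definition _ :=
  GRing.isSubmodClosed.Build R (I -> R^o) fin_supp fin_supp_submod_closed.

Record free_module :=
  FreeModule { free_val : I -> R^o; _ : free_val \in fin_supp }.
HB.instance Definition _ := [isSub for free_val].
HB.instance Definition _ := [Choice of free_module by <:].
HB.instance Definition _ := [SubChoice_isSubLmodule of free_module by <:].

Implicit Types x y : free_module.

Definition coef x i : R := free_val x i.

Lemma free_suppP x :
  exists s, uniq s && `[< forall i, i \notin s -> coef x i = 0 >].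
Proof.
have /asboolP[s xs] : free_val x \in fin_supp by exact: (valP x).
exists (undup s); rewrite undup_uniq; apply/asboolP => i.
by rewrite mem_undup; apply: xs.
Qed.

Definition free_supp x : seq I := xchoose (free_suppP x).

Lemma free_supp_uniq x : uniq (free_supp x).
Proof. by case/andP: (xchooseP (free_suppP x)). Qed.

Lemma free_supp0 x i : i \notin free_supp x -> coef x i = 0.
Proof. by case/andP: (xchooseP (free_suppP x)) => _ /asboolP; apply. Qed.

Fact delta_fin_supp (i : I) : (fun j => (j == i)%:R : R^o) \in fin_supp.
Proof.
by apply/asboolP; exists [:: i] => j; rewrite inE => /negbTE ->.
Qed.
Definition free_delta i : free_module := FreeModule (delta_fin_supp i).

Section Lift.
Variables (N : lmodType R) (a : I -> N).

Definition free_lift x : N := \sum_(i <- free_supp x) coef x i *: a i.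

Lemma free_liftE x s : uniq s -> (forall i, i \notin s -> coef x i = 0) ->
  free_lift x = \sum_(i <- s) coef x i *: a i.
Proof.
have supp (t : seq I) : \sum_(i <- t) coef x i *: a i =
    \sum_(i <- [seq i <- t | coef x i != 0]) coef x i *: a i.
  rewrite big_filter [RHS]big_mkcond; apply: eq_bigr => i _.
  by case: eqP => // ->; rewrite scale0r.
move=> us xs; rewrite /free_lift supp [RHS]supp; apply: perm_big.
apply: uniq_perm; rewrite ?filter_uniq ?free_supp_uniq // => i.
rewrite !mem_filter; case: eqP => //= /eqP xi.
case: (boolP (i \in s)) => [_|/xs /eqP]; last by rewrite (negbTE xi).
by case: (boolP (i \in free_supp x)) => // /free_supp0 /eqP; rewrite (negbTE xi).
Qed.

Fact free_lift_linear : linear free_lift.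
Proof.
move=> r x y; pose s := undup (free_supp x ++ free_supp y).
have us : uniq s by exact: undup_uniq.
have [xs ys] : (forall i, i \notin s -> coef x i = 0) /\
    (forall i, i \notin s -> coef y i = 0).
  by split=> i; rewrite mem_undup mem_cat negb_or => /andP[ix iy];
    apply: free_supp0.
rewrite (free_liftE us xs) (free_liftE us ys) (@free_liftE _ s us); last first.
  move=> i is_; transitivity (r * coef x i + coef y i); first by [].
  by rewrite (xs _ is_) (ys _ is_) mulr0 addr0.
rewrite scaler_sumr -big_split; apply: eq_bigr => i _ /=.
by rewrite scalerA -scalerDl.
Qed.
HB.instance Definition _ :=
  GRing.isLinear.Build R free_module N _ free_lift free_lift_linear.

Lemma free_lift_delta i : free_lift (free_delta i) = a i.
Proof.
rewrite (@free_liftE _ [:: i]) ?big_seq1 /= ?eqxx ?scale1r // => j.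
by rewrite inE => /negbTE ->.
Qed.
End Lift.

Lemma free_expand x : x = \sum_(i <- free_supp x) coef x i *: free_delta i.
Proof.
apply: val_inj; rewrite raddf_sum; apply/funext => j.
rewrite fct_sumE; case: (boolP (j \in free_supp x)) => jx.
  rewrite (bigD1_seq j) ?free_supp_uniq //= big1 ?addr0 => [|i /negbTE ij].
    by rewrite [RHS]/(coef x j * (j == j)%:R) eqxx; exact/esym/mulr1.
  by rewrite [LHS]/(coef x i * (j == i)%:R) eq_sym ij; exact: mulr0.
rewrite [LHS](free_supp0 jx) big_seq big1 // => i ix.
rewrite [LHS]/(coef x i * (j == i)%:R).
case: eqP ix => [<-|_ _]; [by rewrite (negbTE jx) | exact: mulr0].
Qed.

Lemma free_ext (N : lmodType R) (f g : {linear free_module -> N}) :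
  (forall i, f (free_delta i) = g (free_delta i)) -> f =1 g.
Proof.
move=> fg x; rewrite (free_expand x) !linear_sum; apply: eq_bigr => i _.
by rewrite !linearZ /= fg.
Qed.

Lemma free_projective : projective (free_module : lmodType R).
Proof.
move=> A B g f /(_ (f (free_delta _))) gf.
have {}gf (i : I) : exists y : A, g y == f (free_delta i).
  by have [y <-] := gf i; exists y.
exists (free_lift (fun i => xchoose (gf i))).
apply: (@free_ext _ (g \o free_lift _)) => i /=.
by rewrite free_lift_delta; apply/eqP/(xchooseP (gf i)).
Qed.

End FreeModule.

Section Resolution.
Variables (R : pzRingType) (M : lmodType R).

Definition free_cover (N : lmodType R) : {linear free_module R N -> N} :=
  free_lift idfun.

Fixpoint syzygy (n : nat) : lmodType R :=
  if n is m.+1 then kernel (free_cover (syzygy m)) else M.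

Definition free_res (n : nat) : lmodType R := free_module R (syzygy n).

Definition free_res_d (n : nat) : {linear free_res n.+1 -> free_res n} :=
  (\val : kernel (free_cover (syzygy n)) -> free_res n)
    \o free_cover (syzygy n.+1).

Lemma free_cover_surjective N : surjective_map (free_cover N).
Proof. by move=> y; exists (free_delta R y); apply: free_lift_delta. Qed.

Lemma free_res_exact n (C : lmodType R) (g : {linear free_res n -> C}) :
  (forall x, g x = 0 <-> free_cover (syzygy n) x = 0) ->
  exact (free_res_d n) g.
Proof.
move=> gE y; rewrite gE; split=> [/eqP y0|[x <-]].
  have [x xy] := @free_cover_surjective (syzygy n.+1) (Kernel y0).
  by exists x; rewrite /free_res_d /= xy.
by apply/eqP; exact: (valP (free_cover (syzygy n.+1) x)).
Qed.

Lemma projective_resolution_exists :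
  exists (P : nat -> lmodType R) (d : forall n, {linear P n.+1 -> P n})
    (e : {linear P 0%N -> M}), projective_resolution d e.
Proof.
exists free_res, free_res_d, (free_cover M); split=> [n|||n].
- exact: free_projective.
- exact: free_cover_surjective.
- by apply: free_res_exact.
- apply: free_res_exact => x; split=> [h|]; last by rewrite /= => ->.
  by apply: val_inj; apply: h.
Qed.
End Resolution.

(* Main.v *)
(** Only three properties of [L] matter: it contains [R], and it is closed under
    coproducts and summands, so it contains the projectives.  Write [L]-perp for
    the modules with [Ext^i(-, L) = 0] for all [i >= 1].  A module is Gorenstein
    projective iff it has a coresolution by projectives all of whose cosyzygies
    are in [L]-perp: orthogonality makes the coresolution [Hom(-, L)]-exact and
    lets any projective resolution serve as its left half.  This class is closed
    under extensions (projectives are in [L], so maps to them extend along short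
    exact sequences with cokernel in [L]-perp).  A coresolution by Gorenstein
    projectives is turned into one by projectives by embedding each term in a
    projective and absorbing the cokernel with a pushout.  In (4), pushing out
    along an embedding of [G1] into a projective [P] presents [M] as a summand
    of a Gorenstein projective module, with complement [P]. *)

Require Import Defs.
From HB Require Import structures.
From mathcomp Require Import all_boot all_order all_algebra.
From mathcomp Require Import boolp.
Import GRing.Theory.
Local Open Scope ring_scope.

Set Implicit Arguments.
Unset Strict Implicit.
Unset Printing Implicit Defensive.

(** * Cokernels of linear maps *)

Section Cokernel.
Variables (R : pzRingType) (A B : lmodType R) (f : {linear A -> B}).

Definition im_pred : pred B := fun y => `[< exists x, f x = y >].

Fact im_pred_submod_closed : submod_closed im_pred.
Proof.
split=> [|a x y]; first by apply/asboolP; exists 0; rewrite raddf0.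
move=> /asboolP[u <-] /asboolP[v <-]; apply/asboolP.
by exists (a *: u + v); rewrite linearP.
Qed.
HB.instance Definition _ :=
  GRing.isSubmodClosed.Build R B im_pred im_pred_submod_closed.

Definition im_closed : zmodClosed B := GRing.ZmodClosed.clone B im_pred _.

(** The quotient is formed on additive groups; the scalar action is added afterwards through chosen
    representatives. *)
Definition cokernel := {ideal_quot im_closed}.
HB.instance Definition _ := GRing.Zmodule.on cokernel.

Definition coker_proj (x : B) : cokernel := \pi_{ideal_quot im_closed}%qT x.

Lemma coker_projP x y : coker_proj x = coker_proj y <-> exists a, f a = x - y.
Proof.
rewrite /coker_proj; split=> [/eqP|xy].
  by rewrite -Quotient.idealrBE => /asboolP.
by apply/eqP; rewrite -Quotient.idealrBE; apply/asboolP.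
Qed.

Definition coker_scale (r : R) (x : cokernel) : cokernel :=
  coker_proj (r *: repr x).

Lemma coker_scale_proj r x :
  coker_scale r (coker_proj x) = coker_proj (r *: x).
Proof.
have [a fa] : exists a, f a = repr (coker_proj x) - x.
  by apply/coker_projP; rewrite /coker_proj reprK.
by apply/coker_projP; exists (r *: a); rewrite linearZ fa -scalerBr.
Qed.

Lemma coker_proj_surj (x : cokernel) : exists y, coker_proj y = x.
Proof. by exists (repr x); rewrite /coker_proj reprK. Qed.

Lemma coker_projD x y : coker_proj (x + y) = coker_proj x + coker_proj y.
Proof. by rewrite /coker_proj !piE. Qed.

Let scaleA a b v : coker_scale a (coker_scale b v) = coker_scale (a * b) v.
Proof.
by have [x <-] := coker_proj_surj v; rewrite !coker_scale_proj scalerA.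
Qed.
Let scale1 : left_id 1 coker_scale.
Proof.
by move=> v; have [x <-] := coker_proj_surj v; rewrite coker_scale_proj scale1r.
Qed.
Let scaleDr : right_distributive coker_scale +%R.
Proof.
move=> a u v; have [x <-] := coker_proj_surj u;
  have [y <-] := coker_proj_surj v.
by rewrite -coker_projD !coker_scale_proj scalerDr coker_projD.
Qed.
Let scaleDl v : {morph coker_scale^~ v : a b / a + b}.
Proof.
move=> a b; have [x <-] := coker_proj_surj v.
by rewrite !coker_scale_proj scalerDl coker_projD.
Qed.
HB.instance Definition _ := GRing.Zmodule_isLmodule.Build R cokernel
  scaleA scale1 scaleDr scaleDl.

Fact coker_proj_linear : linear coker_proj.
Proof.
move=> a x y; rewrite coker_projD; congr (_ + _); exact/esym/coker_scale_proj.
Qed.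
HB.instance Definition _ :=
  GRing.isLinear.Build R B cokernel _ coker_proj coker_proj_linear.

Lemma coker_exact : exact f coker_proj.
Proof.
move=> y; have -> : coker_proj y = 0 <-> coker_proj y = coker_proj 0.
  by rewrite raddf0.
by rewrite coker_projP subr0.
Qed.
End Cokernel.

(** * Factorization of linear maps, products and kernels *)

Section LinearMaps.
Variable R : pzRingType.
Implicit Types A B C X : lmodType R.

Definition lin A B (f : A -> B) (fl : linear f) : {linear A -> B} :=
  HB.pack f (GRing.isLinear.Build R A B _ f fl).

Lemma inj_ker0 A B (f : {linear A -> B}) :
  (forall x, f x = 0 -> x = 0) -> injective f.
Proof.
by move=> f0 x y xy; apply/eqP; rewrite -subr_eq0; apply/eqP/f0;
  rewrite linearB /= xy subrr.
Qed.

(** Composing [t] with a set-theoretic section of [s] gives a linear map, because [t] takes equal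
    values on elements with the same image under [s]. *)
Lemma factor_surj A B X (s : {linear A -> B}) (t : {linear A -> X}) :
    surjective_map s -> (forall x, s x = 0 -> t x = 0) ->
  exists u : {linear B -> X}, forall x, u (s x) = t x.
Proof.
move=> /choice[r rK] st.
have tr x y : s x = s y -> t x = t y.
  move=> xy; apply/eqP; rewrite -subr_eq0 -raddfB; apply/eqP/st.
  by rewrite linearB /= xy subrr.
have ul : linear (t \o r).
  by move=> a x y /=; rewrite -linearP; apply: tr; rewrite linearP !rK.
by exists (lin ul) => x /=; apply: tr; rewrite rK.
Qed.

Lemma factor_inj A B X (f : {linear A -> B}) (t : {linear X -> B}) :
    injective f -> (forall x, exists a, f a = t x) ->
  exists u : {linear X -> A}, forall x, f (u x) = t x.
Proof.
move=> fI /choice[u uK].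
have ul : linear u by move=> a x y; apply: fI; rewrite linearP !uK linearP.
by exists (lin ul).
Qed.

Section Products.
Variables A B C D : lmodType R.

Fact inl_linear : linear (fun a : A => (a, 0) : (A * B)%type).
Proof. by move=> r x y; congr (_, _); rewrite /= scaler0 addr0. Qed.
Definition inl_map : {linear A -> (A * B)%type} := lin inl_linear.

Fact inr_linear : linear (fun b : B => (0, b) : (A * B)%type).
Proof. by move=> r x y; congr (_, _); rewrite /= scaler0 addr0. Qed.
Definition inr_map : {linear B -> (A * B)%type} := lin inr_linear.

Fact fst_linear : linear (fun x : (A * B)%type => x.1).
Proof. by []. Qed.
Definition fst_map : {linear (A * B)%type -> A} := lin fst_linear.

Fact snd_linear : linear (fun x : (A * B)%type => x.2).
Proof. by []. Qed.
Definition snd_map : {linear (A * B)%type -> B} := lin snd_linear.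

Lemma pair_linear (f : {linear C -> A}) (g : {linear C -> B}) :
  linear (fun x => (f x, g x) : (A * B)%type).
Proof. by move=> r x y; congr (_, _); rewrite /= linearP. Qed.
Definition pair_map f g : {linear C -> (A * B)%type} := lin (pair_linear f g).

Lemma copair_linear (f : {linear A -> C}) (g : {linear B -> C}) :
  linear (fun x : (A * B)%type => f x.1 + g x.2).
Proof. by move=> r x y; rewrite /= !linearP scalerDr addrACA. Qed.
Definition copair_map f g : {linear (A * B)%type -> C} :=
  lin (copair_linear f g).
End Products.

Lemma kernelP A B (f : {linear A -> B}) (x : kernel f) : f (\val x) = 0.
Proof. by apply/eqP; exact: (valP x). Qed.

Definition ker_inj A B (f : {linear A -> B}) : {linear kernel f -> A} := \val.

Lemma kernel_lift A B (f : {linear A -> B}) y :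
  f y = 0 -> exists x : kernel f, ker_inj f x = y.
Proof. by move=> /eqP fy; exists (Kernel fy). Qed.

Lemma kernel_short_exact A B (f : {linear A -> B}) :
  surjective_map f -> short_exact (ker_inj f) f.
Proof.
split=> // [|y]; first exact: val_inj.
by split=> [/kernel_lift//|[x <-]]; exact: kernelP.
Qed.

Lemma exact0 A B C (f : {linear A -> B}) (g : {linear B -> C}) x :
  exact f g -> g (f x) = 0.
Proof. by move=> fg; apply/fg; exists x. Qed.

End LinearMaps.

(** * Pullbacks, pushouts, composites and the horseshoe lemma *)

Section Diagrams.
Variable R : pzRingType.
Implicit Types A B C D E K P S T X : lmodType R.

(** [Z] is the kernel of the difference of [g] and [p] on the product of [B] and [P]; each
    projection of [Z] is onto, with the kernel of the opposite epimorphism. *)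
Lemma pullback A B C K P (f : {linear A -> B}) (g : {linear B -> C})
    (k : {linear K -> P}) (p : {linear P -> C}) :
    short_exact f g -> short_exact k p ->
  exists (Z : lmodType R) (a : {linear A -> Z}) (q : {linear Z -> P})
      (b : {linear K -> Z}) (r : {linear Z -> B}),
    [/\ short_exact a q, short_exact b r, forall x, r (a x) = f x,
        forall x, q (b x) = k x & forall z, g (r z) = p (q z)].
Proof.
move=> [fI fgE gS] [kI kpE pS].
have hl : linear (fun x : (B * P)%type => g x.1 - p x.2).
  by move=> r x y; rewrite /= !linearP /= scalerDr addrACA.
pose h := lin hl.
have hE (z : kernel h) :
  g (fst_map _ _ (ker_inj h z)) = p (snd_map _ _ (ker_inj h z)).
  by apply/eqP; rewrite -subr_eq0; apply/eqP; exact: (kernelP z).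
have lift x y : g x = p y -> exists z, ker_inj h z = (x, y).
  by move=> xy; apply: kernel_lift; rewrite /= xy subrr.
have kerI : injective (ker_inj h) by exact: val_inj.
have [|a aE] := @factor_inj _ _ _ _ (ker_inj h) (inl_map B P \o f) kerI.
  by move=> x; apply: lift; rewrite (exact0 _ fgE) raddf0.
have [|b bE] := @factor_inj _ _ _ _ (ker_inj h) (inr_map B P \o k) kerI.
  by move=> x; apply: lift; rewrite (exact0 _ kpE) raddf0.
exists (kernel h), a, (snd_map _ _ \o ker_inj h), b, (fst_map _ _ \o ker_inj h).
split=> [||x|x|z]; last exact: hE.
- split=> [x y xy|z|y].
  + by apply: fI; have := congr1 (ker_inj h) xy; rewrite !aE => -[].
  + split=> [/= z2|[x <-]]; last by rewrite /= [X in X.2]aE.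
    have := hE z; rewrite /= z2 raddf0 => /fgE[x xz].
    exists x; apply: kerI; rewrite aE /= xz -z2; by case: (\val z).
  + have [x xy] := gS (p y); have [z zE] := lift _ _ xy.
    by exists z; rewrite /= [X in X.2]zE.
- split=> [x y xy|z|y].
  + by apply: kI; have := congr1 (ker_inj h) xy; rewrite !bE => -[].
  + split=> [/= z1|[x <-]]; last by rewrite /= [X in X.1]bE.
    have := hE z; rewrite /= z1 raddf0 => /esym/kpE[x xz].
    exists x; apply: kerI; rewrite bE /= xz -z1; by case: (\val z).
  + have [x xy] := pS (g y); have [z zE] := lift _ _ (esym xy).
    by exists z; rewrite /= [X in X.1]zE.
- by rewrite /= [X in X.1]aE.
- by rewrite /= [X in X.2]bE.
Qed.

(** [Z] is the preimage in [T] of the submodule [A] of [B]; restricting [t] to it leaves the kernel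
    [S] unchanged. *)
Lemma kernel_of_comp A B C S T (f : {linear A -> B}) (g : {linear B -> C})
    (s : {linear S -> T}) (t : {linear T -> B}) :
    short_exact f g -> short_exact s t ->
  exists (Z : lmodType R) (u : {linear S -> Z}) (v : {linear Z -> A})
    (w : {linear Z -> T}),
    [/\ short_exact u v, short_exact w (g \o t) & forall x, w (u x) = s x].
Proof.
move=> [fI fgE gS] [sI stE tS].
pose h := [the {linear T -> C} of g \o t].
have hS : surjective_map h.
  by move=> c; have [b <-] := gS c; have [x <-] := tS b; exists x.
have [u uE] : exists u :
  {linear S -> kernel h}, forall x, ker_inj h (u x) = s x.
  apply: factor_inj => [|x]; first exact: val_inj.
  by apply: kernel_lift; rewrite /= (exact0 _ stE) raddf0.
have [v vE] : exists v :
  {linear kernel h -> A}, forall z, f (v z) = t (ker_inj h z).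
  apply: (@factor_inj _ _ _ _ f (t \o ker_inj h)) => // z.
  by apply/fgE; exact: (kernelP z).
exists (kernel h), u, v, (ker_inj h).
split=> //; last exact: kernel_short_exact.
split=> [x y /(congr1 (ker_inj h))|z|a].
- by rewrite !uE; apply: sI.
- split=> [/(congr1 f)|[x <-]].
    rewrite vE raddf0 => /stE[x xz]; exists x.
    by apply: val_inj; rewrite -[LHS]/(ker_inj h (u x)) uE.
  by apply: fI; rewrite vE uE (exact0 _ stE) raddf0.
- have [y yE] := tS (f a); have [|z zE] := @kernel_lift _ _ _ h y.
    by rewrite /= yE (exact0 _ fgE).
  by exists z; apply: fI; rewrite vE zE.
Qed.

(** A lift [l] of [p'] through [g], together with [f \o p], covers [B]; the kernels of the three
    covers then form a short exact sequence. *)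
Lemma horseshoe A B C K P K' P' (f : {linear A -> B}) (g : {linear B -> C})
    (k : {linear K -> P}) (p : {linear P -> A})
    (k' : {linear K' -> P'}) (p' : {linear P' -> C}) :
    short_exact f g -> short_exact k p -> short_exact k' p' -> projective P' ->
  exists (Z : lmodType R) (u : {linear K -> Z}) (v : {linear Z -> K'})
      (w : {linear Z -> (P * P')%type}) (q : {linear (P * P')%type -> B}),
    [/\ short_exact u v, short_exact w q & forall x, w (u x) = (k x, 0)].
Proof.
move=> [fI fgE gS] [kI kpE pS] [k'I k'pE p'S] P'proj.
have [l lE] := P'proj _ _ g p' gS.
pose q := copair_map (f \o p) l.
have gq x : g (q x) = p' x.2.
  by rewrite /= linearD /= (exact0 _ fgE) add0r lE.
have qS : surjective_map q.
  move=> b; have [y yE] := p'S (g b).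
  have /fgE[a aE] : g (b - l y) = 0 by rewrite linearB /= lE yE subrr.
  by have [x xE] := pS a; exists (x, y); rewrite /= xE aE subrK.
have [u uE] : exists u : {linear K -> kernel q},
    forall x, ker_inj q (u x) = (k x, 0).
  apply: (@factor_inj _ _ _ _ (ker_inj q) (inl_map P P' \o k)) => [|x].
    exact: val_inj.
  by apply: kernel_lift; rewrite /= (exact0 _ kpE) !raddf0 addr0.
have [v vE] : exists v : {linear kernel q -> K'},
    forall z, k' (v z) = (ker_inj q z).2.
  apply: (@factor_inj _ _ _ _ k' (snd_map _ _ \o ker_inj q)) => // z.
  by apply/k'pE; rewrite -[LHS]gq [q _]kernelP raddf0.
exists (kernel q), u, v, (ker_inj q), q.
split=> //; last exact: kernel_short_exact.
split=> [x y /(congr1 (ker_inj q))|z|x'].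
- by rewrite !uE => -[/kI].
- split=> [/(congr1 k')|[x <-]].
    rewrite vE raddf0 => z2; have /kpE[x xE] : p (ker_inj q z).1 = 0.
      apply: fI; rewrite raddf0; have := kernelP z.
      by rewrite /= -[\val z]/(ker_inj q z) z2 raddf0 addr0.
    exists x; apply: val_inj; rewrite -[LHS]/(ker_inj q (u x)) uE xE -z2.
    by rewrite [RHS]surjective_pairing.
  by apply: k'I; rewrite vE uE raddf0.
(* The element [l (k' x')] comes from [A], so it can be cancelled by a first component in [P]; this
   lifts [x'] to the kernel of [q]. *)
- have /fgE[a aE] : g (l (k' x')) = 0 by rewrite lE (exact0 _ k'pE).
  have [x xE] := pS a; have [|z zE] := @kernel_lift _ _ _ q (- x, k' x').
    by rewrite /= !raddfN /= xE aE addNr.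
  by exists z; apply: k'I; rewrite vE zE.
Qed.

Lemma coker_short_exact A B (f : {linear A -> B}) :
  injective f -> short_exact f (coker_proj f).
Proof.
by move=> fI; split=> //; [exact: coker_exact|exact: coker_proj_surj].
Qed.

(** [T] is the cokernel of [a |-> (f a, - f' a)]; injectivity of one leg makes the opposite leg of
    the square injective. *)
Lemma pushout A B C D E (f : {linear A -> B}) (g : {linear B -> C})
    (f' : {linear A -> D}) (g' : {linear D -> E}) :
    short_exact f g -> short_exact f' g' ->
  exists (T : lmodType R) (u : {linear B -> T}) (p : {linear T -> E})
      (v : {linear D -> T}) (q : {linear T -> C}),
    short_exact u p /\ short_exact v q.
Proof.
move=> [fI fgE gS] [f'I f'gE g'S].
have il : linear (fun x => (f x, - f' x) : (B * D)%type).
  by move=> r x y; congr (_, _); rewrite /= linearP // opprD scalerN.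
pose i := lin il.
pose c := [the {linear (B * D)%type -> cokernel i} of coker_proj i].
have cS : surjective_map c by exact: coker_proj_surj.
have cE : exact i c by exact: coker_exact.
have [p pE] : exists p : {linear cokernel i -> E}, forall x, p (c x) = g' x.2.
  apply: (@factor_surj _ _ _ _ c (g' \o snd_map _ _)) => // x /cE[a <-].
  by rewrite /= raddfN /= (exact0 _ f'gE) oppr0.
have [q qE] : exists q : {linear cokernel i -> C}, forall x, q (c x) = g x.1.
  apply: (@factor_surj _ _ _ _ c (g \o fst_map _ _)) => // x /cE[a <-].
  by rewrite /= (exact0 _ fgE).
exists (cokernel i), (c \o inl_map _ _), p, (c \o inr_map _ _), q.
split; split.
- apply: inj_ker0 => x /cE[a []] <- /eqP; rewrite oppr_eq0 => /eqP a0.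
  have -> : a = 0 by apply: f'I; rewrite a0 raddf0.
  by rewrite raddf0.
- move=> t; have [[x y] <-] := cS t; rewrite pE /=.
  split=> [/f'gE[a aE]|[z zE]].
    exists (x + f a); apply/eqP; rewrite -subr_eq0 -linearB.
    apply/eqP/cE; exists a; rewrite -aE.
    by congr (_, _); rewrite /= ?sub0r // addrAC subrr add0r.
  by have := congr1 p zE; rewrite /= !pE /= raddf0.
- by move=> z; have [y <-] := g'S z; exists (c (0, y)); rewrite pE.
- apply: inj_ker0 => y /cE[a [a0 aE]]; rewrite -aE.
  have -> : a = 0 by apply: fI; rewrite a0 raddf0.
  by rewrite raddf0 oppr0.
- move=> t; have [[x y] <-] := cS t; rewrite qE /=.
  split=> [/fgE[a aE]|[z zE]].
    exists (y + f' a); apply/eqP; rewrite -subr_eq0 -linearB.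
    apply/eqP/cE; exists (- a); rewrite -aE.
    by congr (_, _); rewrite /= ?sub0r ?raddfN //= opprK addrAC subrr add0r.
  by have := congr1 q zE; rewrite /= !qE /= raddf0.
- by move=> z; have [y <-] := gS z; exists (c (y, 0)); rewrite qE.
Qed.

(** With [A] inside [B] inside [D], this is the third isomorphism theorem: [D/A] is an extension of
    [D/B] by [B/A]. *)
Lemma cokernel_of_comp A B C D E (f : {linear A -> B}) (g : {linear B -> C})
    (f' : {linear B -> D}) (g' : {linear D -> E}) :
    short_exact f g -> short_exact f' g' ->
  exists (T : lmodType R) (h : {linear D -> T}) (u : {linear C -> T})
    (v : {linear T -> E}),
    short_exact (f' \o f) h /\ short_exact u v.
Proof.
move=> [fI fgE gS] [f'I f'gE g'S].
pose i := [the {linear A -> D} of f' \o f].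
pose c := [the {linear D -> cokernel i} of coker_proj i].
have cS : surjective_map c by exact: coker_proj_surj.
have cE : exact i c by exact: coker_exact.
have [v vE] : exists v : {linear cokernel i -> E}, forall x, v (c x) = g' x.
  apply: factor_surj => // x /cE[a <-].
  by rewrite /= (exact0 _ f'gE).
have [u uE] : exists u : {linear C -> cokernel i}, forall x, u (g x) = c (f' x).
  apply: (@factor_surj _ _ _ _ g (c \o f')) => // x /fgE[a <-].
  by rewrite /=; apply/cE; exists a.
exists (cokernel i), c, u, v; split.
  by apply: coker_short_exact; exact: inj_comp.
split.
- apply: inj_ker0 => z; have [y <-] := gS z; rewrite uE => /cE[a aE].
  by rewrite -(f'I _ _ aE) (exact0 _ fgE).
- move=> t; have [y <-] := cS t; rewrite vE; split=> [/f'gE[b <-]|[z]].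
    by exists (g b); rewrite uE.
  by have [b <-] := gS z; rewrite uE => /(congr1 v);
    rewrite !vE (exact0 _ f'gE).
- by move=> e; have [y <-] := g'S e; exists (c y); rewrite vE.
Qed.

End Diagrams.

(** * Splittings and projective modules *)

Section Projectives.
Variable R : pzRingType.
Implicit Types A B C K P X : lmodType R.

Lemma isomorphic_sym A B : isomorphic A B -> isomorphic B A.
Proof.
move=> [f [g fK gK]].
have gl : linear g.
  by move=> a x y; apply: (can_inj fK); rewrite linearP !gK.
by exists (lin gl), f.
Qed.

Lemma isomorphic_refl A : isomorphic A A.
Proof. by exists idfun, idfun. Qed.

Lemma projective_split A B P (f : {linear A -> B}) (g : {linear B -> P}) :
  projective P -> short_exact f g ->
  exists s : {linear P -> B}, forall x, g (s x) = x.
Proof. by move=> Pp [_ _ gS]; exact: (Pp _ _ g idfun gS). Qed.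

Lemma split_isomorphic A B C (f : {linear A -> B}) (g : {linear B -> C})
    (s : {linear C -> B}) :
  short_exact f g -> (forall x, g (s x) = x) -> isomorphic B (C * A)%type.
Proof.
move=> [fI fgE gS] sK.
(* The projection complementary to [s \o g] lands in the image of [f], which yields a retraction
   onto [A]. *)
have tB x : exists a, f a = (idfun \- (s \o g) : {linear B -> B}) x.
  by apply/fgE; rewrite /= linearB /= sK subrr.
have [t tE] := factor_inj fI tB.
exists (pair_map g t), (fun y => s y.1 + f y.2) => [x|[x y]] /=.
  by rewrite tE /= addrC subrK.
have gE : g (s x + f y) = x by rewrite linearD sK (exact0 _ fgE) addr0.
by congr (_, _) => //; apply: fI; rewrite tE /= gE addrAC subrr add0r.
Qed.

Lemma projective_summand P B : direct_summand B P -> projective P ->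
  projective B.
Proof.
move=> [C [f [f' fK f'K]]] Pp X Y g h gS.
have f'l : linear f' by move=> a x y; apply: (can_inj fK); rewrite linearP !f'K.
have [k kE] := Pp _ _ g (h \o fst_map B C \o f) gS.
exists (k \o lin f'l \o inl_map B C) => x /=.
by rewrite kE /= f'K.
Qed.

Lemma projective_prod P (Q : lmodType R) :
  projective P -> projective Q -> projective (P * Q)%type.
Proof.
move=> Pp Qp A B g f gS.
have [h hE] := Pp _ _ g (f \o inl_map _ _) gS.
have [k kE] := Qp _ _ g (f \o inr_map _ _) gS.
exists (copair_map h k) => x; rewrite /= linearD hE kE /= -linearD.
by congr (f _); case: x => a b; congr (_, _); rewrite /= ?addr0 ?add0r.
Qed.

Lemma projective_iso_closed : iso_closed (@projective R).
Proof.
move=> P Q /isomorphic_sym[f [f' fK f'K]] Pp A B g h gS.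
have f'l : linear f' by move=> a x y; apply: (can_inj fK); rewrite linearP !f'K.
have [k kE] := Pp _ _ g (h \o lin f'l) gS.
by exists (k \o f) => x; rewrite /= kE /= fK.
Qed.

Lemma free_presentation C :
  exists K P (k : {linear K -> P}) (p : {linear P -> C}),
    projective P /\ short_exact k p.
Proof.
exists (kernel (free_cover C)), (free_module R C), (ker_inj _), (free_cover C).
by split; [exact:
  free_projective|exact/kernel_short_exact/free_cover_surjective].
Qed.

End Projectives.

(** * Orthogonality to the class and its behaviour in short exact sequences *)

Section Orthogonal.
Variables (R : pzRingType) (L : module_class R).
Implicit Types A B C K M N P X : lmodType R.

(* Ext^1(M, L) = 0: every map from a kernel of an epimorphism onto M to a module
   in L extends. *)
Definition ext1_perp M := forall X, L X ->
  forall A B (f : {linear A -> B}) (g : {linear B -> M}),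
    short_exact f g -> hom_surjective f X.

(* Ext^i(M, L) = 0 for 1 <= i <= n, by dimension shifting. *)
Fixpoint ext_perp_upto n M : Prop :=
  if n is m.+1 then
    ext1_perp M /\ forall K P (k : {linear K -> P}) (p : {linear P -> M}),
      projective P -> short_exact k p -> ext_perp_upto m K
  else True.

Definition ext_perp M := forall n, ext_perp_upto n M.

(** One projective presentation suffices to test vanishing of the first Ext group. A lift [l] of [p]
    restricts to [j : K -> A] and makes [B] the pushout of [P] and [A] along [K]; an extension of
    [h \o j] to [P] and the map [h] itself then glue to a map on [B]. *)
Lemma hom_surjective_presentation A B K P M X
    (f : {linear A -> B}) (g : {linear B -> M})
    (k : {linear K -> P}) (p : {linear P -> M}) :
    short_exact f g -> short_exact k p -> projective P ->
  hom_surjective k X -> hom_surjective f X.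
Proof.
move=> [fI fgE gS] [kI kpE pS] Pp kX h.
have [l lE] := Pp _ _ g p gS.
have [|j jE] := @factor_inj _ _ _ _ f (l \o k) fI.
  by move=> x; apply/fgE; rewrite /= lE (exact0 _ kpE).
have [m mE] := kX (h \o j).
have sS : surjective_map (copair_map l f).
  move=> b; have [x xE] := pS (g b).
  have /fgE[a aE] : g (b - l x) = 0 by rewrite linearB /= lE xE subrr.
  by exists (x, a); rewrite /= aE addrC subrK.
have [|u uE] := @factor_surj _ _ _ _ _ (copair_map m h) sS.
  move=> [x a] /= xa; have /kpE[y yE] : p x = 0.
    by have := congr1 g xa; rewrite linearD /= lE (exact0 _ fgE) addr0 raddf0.
  have -> : a = - j y.
    apply: fI; rewrite raddfN /= jE /= yE; apply/eqP.
    by rewrite -addr_eq0 addrC xa.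
  by rewrite -yE mE /= raddfN /= subrr.
by exists u => a; have := uE (0, a); rewrite /= !raddf0 !add0r.
Qed.

Lemma ext1_perp_presentation K P M (k : {linear K -> P}) (p : {linear P -> M}) :
    projective P -> short_exact k p ->
  (forall X, L X -> hom_surjective k X) -> ext1_perp M.
Proof.
move=> Pp kp kX X LX A B f g fg.
exact: hom_surjective_presentation fg kp Pp (kX X LX).
Qed.

Lemma projective_ext1_perp P : projective P -> ext1_perp P.
Proof.
move=> Pp X LX A B f g fg h.
have [s sE] := projective_split Pp fg; case: fg => fI fgE gS.
have tB x : exists a, f a = (idfun \- (s \o g) : {linear B -> B}) x.
  by apply/fgE; rewrite /= linearB /= sE subrr.
have [t tE] := factor_inj fI tB.
exists (h \o t) => x /=; congr (h _); apply: fI.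
by rewrite tE /= (exact0 _ fgE) raddf0 subr0.
Qed.

Lemma ext_perp_ext1 M : ext_perp M -> ext1_perp M.
Proof. by move=> /(_ 1%N)[]. Qed.

Lemma ext_perp_syzygy K P M (k : {linear K -> P}) (p : {linear P -> M}) :
  projective P -> short_exact k p -> ext_perp M -> ext_perp K.
Proof. by move=> Pp kp Mp n; have [_] := Mp n.+1; apply; eassumption. Qed.

Lemma projective_kernel K P (Q : lmodType R) (k : {linear K -> P})
  (p : {linear P -> Q}) :
  projective P -> projective Q -> short_exact k p -> projective K.
Proof.
move=> Pp Qp kp; have [s sE] := projective_split Qp kp.
have [f [f' fK f'K]] := split_isomorphic kp sE.
apply: (@projective_summand _ P K _ Pp); exists Q.
have hl : linear (fun x : P => ((f x).2, (f x).1) : (K * Q)%type).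
  by move=> a x y; rewrite linearP.
exists (lin hl), (fun y => f' (y.2, y.1)) => [x|[x y]] /=.
  by rewrite -surjective_pairing fK.
by rewrite f'K.
Qed.

Lemma projective_ext_perp P : projective P -> ext_perp P.
Proof.
move=> Pp n; elim: n P Pp => //= n IHn P Pp.
split=> [|K Q k q Qp kq]; first exact: projective_ext1_perp.
exact/IHn/(projective_kernel Qp Pp kq).
Qed.

(** The horseshoe lemma turns the sequence into one of syzygies, [K -> Z -> K']. A map on [K]
    extends to [Z] because [K'] is orthogonal, and then to the projective middle term because [B]
    is; higher degrees follow by induction on the syzygies. *)
Lemma ext_perp_upto_kernel n A B C (f : {linear A -> B}) (g : {linear B -> C}) :
    short_exact f g -> ext_perp_upto n B -> ext_perp_upto n.+1 C ->
  ext_perp_upto n A.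
Proof.
elim: n A B C f g => // n IHn A B C f g fg [B1 Bn] [C1 Cn].
have [K' [P' [k' [p' [P'p kp']]]]] := free_presentation C.
have K'n := Cn _ _ _ _ P'p kp'.
split.
  have [K [P [k [p [Pp kp]]]]] := free_presentation A.
  have [Z [u [v [w [q [uv wq wE]]]]]] := horseshoe fg kp kp' P'p.
  apply: (ext1_perp_presentation Pp kp) => X LX h.
  have [h' h'E] := K'n.1 X LX _ _ _ _ uv h.
  have [h'' h''E] := B1 X LX _ _ _ _ wq h'.
  by exists (h'' \o inl_map _ _) => x; rewrite /= -wE h''E h'E.
move=> K P k p Pp kp.
have [Z [u [v [w [q [uv wq wE]]]]]] := horseshoe fg kp kp' P'p.
exact: IHn uv (Bn _ _ _ _ (projective_prod Pp P'p) wq) K'n.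
Qed.

(** A map on [S] is extended first over the preimage [Z] of [A], then over [T]. In higher degrees, a
    syzygy of [B] is the kernel of an epimorphism from a syzygy of [C] onto [A]. *)
Lemma ext_perp_upto_extension n A B C (f : {linear A -> B})
  (g : {linear B -> C}) :
    short_exact f g -> ext_perp_upto n A -> ext_perp_upto n C ->
  ext_perp_upto n B.
Proof.
case: n => // n fg An Cn; split.
  move=> X LX S T s t st h.
  have [Z [u [v [w [uv wt wE]]]]] := kernel_of_comp fg st.
  have [h' h'E] := An.1 X LX _ _ _ _ uv h.
  have [h'' h''E] := Cn.1 X LX _ _ _ _ wt h'.
  by exists h'' => x; rewrite -wE h''E h'E.
move=> K P k p Pp kp.
have [Z [u [v [w [uv wt wE]]]]] := kernel_of_comp fg kp.
exact: ext_perp_upto_kernel uv (Cn.2 _ _ _ _ Pp wt) An.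
Qed.

(** The pullback [Z] of [B] and [P] over [C] is an extension of [P] by [A], and the syzygy [K] of
    [C] is the kernel of [Z -> B]. *)
Lemma ext_perp_upto_cokernel n A B C (f : {linear A -> B})
  (g : {linear B -> C}) :
    short_exact f g -> ext1_perp C -> ext_perp_upto n A ->
  ext_perp_upto n.+1 B -> ext_perp_upto n.+1 C.
Proof.
move=> fg C1 An Bn; split=> // K P k p Pp kp.
have [Z [a [q [b [r [aq br _ _ _]]]]]] := pullback fg kp.
have Zn := ext_perp_upto_extension aq An (projective_ext_perp Pp n).
exact: ext_perp_upto_kernel br Zn Bn.
Qed.

(** Extend [h] to [m] on the pullback, extend the restriction of [m] to [A] over [B], and subtract:
    the difference vanishes on [A], hence descends to [T]. *)
Lemma ext1_perp_cokernel A B C (f : {linear A -> B}) (g : {linear B -> C}) :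
    short_exact f g -> (forall X, L X -> hom_surjective f X) ->
  ext1_perp B -> ext1_perp C.
Proof.
move=> fg fX B1 X LX S T s t st h.
have [Z [a [q [b [r [aq br raE qbE _]]]]]] := pullback fg st.
have [m mE] := B1 X LX _ _ _ _ br h.
have [l lE] := fX X LX (m \o a).
have [|u uE] := @factor_surj _ _ _ _ q (m \- (l \o r))
  (let: And3 _ _ qS := aq in qS).
  by case: aq => _ aqE _ x /aqE[y <-]; rewrite /= raE lE subrr.
exists u => x; rewrite -qbE uE /= mE; case: br => _ /exact0 -> _.
by rewrite raddf0 subr0.
Qed.

Lemma ext_perp_kernel A B C (f : {linear A -> B}) (g : {linear B -> C}) :
  short_exact f g -> ext_perp B -> ext_perp C -> ext_perp A.
Proof. by move=> fg Bp Cp n;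
  exact: ext_perp_upto_kernel fg (Bp n) (Cp n.+1). Qed.

Lemma ext_perp_extension A B C (f : {linear A -> B}) (g : {linear B -> C}) :
  short_exact f g -> ext_perp A -> ext_perp C -> ext_perp B.
Proof. by move=> fg Ap Cp n;
  exact: ext_perp_upto_extension fg (Ap n) (Cp n). Qed.

Lemma ext_perp_cokernel A B C (f : {linear A -> B}) (g : {linear B -> C}) :
    short_exact f g -> (forall X, L X -> hom_surjective f X) ->
  ext_perp A -> ext_perp B -> ext_perp C.
Proof.
move=> fg fX Ap Bp [|n] //.
have C1 := ext1_perp_cokernel fg fX (ext_perp_ext1 Bp).
exact: ext_perp_upto_cokernel fg C1 (Ap n) (Bp n.+1).
Qed.

End Orthogonal.

(** * Orthogonality as vanishing of Ext computed by resolutions *)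

Section ExtVanishing.
Variables (R : pzRingType) (L : module_class R).
Implicit Types A B C K M N P X : lmodType R.

Lemma resolution_tail (P : nat -> lmodType R)
    (d : forall n, {linear P n.+1 -> P n}) M (e : {linear P 0%N -> M}) :
    projective_resolution d e ->
  exists e' : {linear P 1%N -> kernel e},
    projective_resolution (fun n => d n.+1) e' /\
    forall x, ker_inj e (e' x) = d 0%N x.
Proof.
move=> [Pp eS deE dE].
have [|e' e'E] := @factor_inj _ _ _ _ (ker_inj e) (d 0%N) val_inj.
  by move=> x; apply: kernel_lift; rewrite (exact0 _ deE).
exists e'; split=> //; split=> // [y|y].
  have /deE[x xE] := kernelP y; exists x.
  by apply: val_inj; rewrite -[LHS]/(ker_inj e (e' x)) e'E xE.
rewrite -dE -e'E; split=> [->|e'0]; first by rewrite raddf0.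
by apply: val_inj; rewrite -[LHS]/(ker_inj e (e' y)) e'0 raddf0.
Qed.

Lemma resolution_cons (P : nat -> lmodType R)
    (d : forall n, {linear P n.+1 -> P n}) K (Q : lmodType R) M
      (e : {linear P 0%N -> K})
    (k : {linear K -> Q}) (q : {linear Q -> M}) :
    projective_resolution d e -> projective Q -> short_exact k q ->
  projective_resolution
    (P := fun n => if n is m.+1 then P m else Q)
    (fun n => if n is m.+1 then d m else k \o e) q.
Proof.
move=> [Pp eS deE dE] Qp [kI kqE qS]; split=> // [[]//|y|[|n]//].
  rewrite kqE; split=> [[x <-]|[x <-]]; last by exists (e x).
  by have [z <-] := eS x; exists z.
move=> y; rewrite -deE /=; split=> [|->]; last exact: raddf0.
by rewrite -[X in _ = X](raddf0 k); apply: kI.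
Qed.

(** A 1-cocycle is a map on the first syzygy [kernel e], and it is a coboundary exactly when that
    map extends to [P 0]. *)
Lemma ext1_perpP M :
  (forall X, L X -> Ext_eq0 1 M X) <-> ext1_perp L M.
Proof.
split=> [M0|M1 X LX P d e Pde c c0].
  have [P [d [e Pde]]] := projective_resolution_exists M.
  have [e' [[_ e'S de'E _] e'E]] := resolution_tail Pde.
  have [Pp eS _ _] := Pde.
  apply: (ext1_perp_presentation (Pp 0%N) (kernel_short_exact eS)) => X LX h.
  have [|b bE] := M0 X LX P d e Pde (h \o e').
    by move=> x; rewrite /= (exact0 _ de'E) raddf0.
  by exists b => x; have [y <-] := e'S x; rewrite e'E -bE.
have [e' [[_ e'S de'E _] e'E]] := resolution_tail Pde.
have [|h hE] := @factor_surj _ _ _ _ e' c e'S.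
  by move=> x /de'E[y <-].
have [_ eS _ _] := Pde.
have [b bE] := M1 X LX _ _ _ _ (kernel_short_exact eS) h.
by exists b => x; rewrite -e'E bE hE.
Qed.

Lemma ext_perpP M :
  (forall X i, L X -> (1 <= i)%N -> Ext_eq0 i M X) <-> ext_perp L M.
Proof.
split=> [M0 n|Mp X [//|i] LX _].
  elim: n M M0 => // n IHn M M0; split=> [|K Q k q Qp kq].
    by apply/ext1_perpP => X LX; exact: M0.
  (* Prolonging a resolution of [K] by [Q] resolves [M], so degree [i.+1] for [K] is degree [i.+2]
     for [M]. *)
  apply: IHn => X [//|i] LX _ P d e Pde c c0.
  exact: (M0 X i.+2 LX isT _ _ _ (resolution_cons Pde Qp kq) c).
elim: i M Mp => [|i IHi] M Mp;
  first exact: (ext1_perpP M).2 (ext_perp_ext1 Mp) _ _.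
move=> P d e Pde c c0; have [e' [Pde' _]] := resolution_tail Pde.
have [Pp eS _ _] := Pde.
have Kp := ext_perp_syzygy (Pp 0%N) (kernel_short_exact eS) Mp.
exact: (IHi _ Kp _ _ _ Pde' c c0).
Qed.

End ExtVanishing.

(** * Splicing short exact sequences and choosing them successively *)

Section Splicing.
Variable R : pzRingType.
Implicit Types A B G S X : lmodType R.

Lemma splice_exact S A G B G' (u : {linear S -> A}) (f : {linear A -> G})
    (g : {linear G -> B}) (f' : {linear B -> G'}) :
  surjective_map u -> short_exact f g -> injective f' ->
  exact (f \o u) (f' \o g).
Proof.
move=> uS [_ fgE _] f'I y /=; split=> [|[x <-]]; last first.
  by rewrite (exact0 _ fgE) raddf0.
rewrite -[X in _ = X](raddf0 f') => /f'I/fgE[a <-].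
by have [x <-] := uS a; exists x.
Qed.

(** A map killing the image of [f] factors through [g], and the factor extends along [f']. *)
Lemma splice_hom_exact S A G B G' X (u : {linear S -> A}) (f : {linear A -> G})
    (g : {linear G -> B}) (f' : {linear B -> G'}) :
  surjective_map u -> short_exact f g -> hom_surjective f' X ->
  hom_exact (f \o u) (f' \o g) X.
Proof.
move=> uS [_ fgE gS] f'X h; split=> [hfu|[k kE] x]; last first.
  by rewrite -kE /= (exact0 _ fgE) !raddf0.
have [|k kE] := @factor_surj _ _ _ _ g h gS.
  by move=> y /fgE[a <-]; have [x <-] := uS a; exact: hfu.
by have [m mE] := f'X k; exists m => y; rewrite /= mE kE.
Qed.

Lemma dependent_choice (W : module_class R)
    (step : lmodType R -> lmodType R -> Prop) M :
    W M -> (forall N, W N -> exists N', W N' /\ step N N') ->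
  exists z : nat -> lmodType R, z 0%N = M /\ forall n, step (z n) (z n.+1).
Proof.
move=> WM next.
pose nxt (s : {N | W N}) : {N | W N} :=
  let c := cid (next (sval s) (svalP s)) in exist _ (sval c) (svalP c).1.
exists (fun n => sval (iter n nxt (exist _ M WM))); split=> // n.
exact: (svalP (cid (next _ _))).2.
Qed.

End Splicing.

(** * Coresolutions and complete resolutions through their cosyzygies *)

Section Coresolved.
Variables (R : pzRingType) (L : module_class R).
Implicit Types (A B C G M N P Q X : lmodType R) (K : module_class R).

(** One short exact piece of a Hom(-,L)-exact sequence with terms in [K]; long sequences are cut
    into such pieces and spliced from them. *)
Definition exact_step K N N' :=
  exists (G : lmodType R) (f : {linear N -> G}) (g : {linear G -> N'}),
    [/\ K G, short_exact f g & forall X, L X -> hom_surjective f X].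

Lemma exact_step_choice (I : Type) K (a b : I -> lmodType R) :
    (forall i, exact_step K (a i) (b i)) ->
  exists (G : I -> lmodType R) (f : forall i, {linear a i -> G i})
      (g : forall i, {linear G i -> b i}),
    forall i, [/\ K (G i), short_exact (f i) (g i)
                & forall X, L X -> hom_surjective (f i) X].
Proof.
move=> H; exists (fun i => sval (cid (H i))).
exists (fun i => sval (cid (svalP (cid (H i))))).
exists (fun i => sval (cid (svalP (cid (svalP (cid (H i))))))) => i.
exact: svalP (cid (svalP (cid (svalP (cid (H i)))))).
Qed.

Lemma exact_step_iso K N1 N2 N1' N2' :
    isomorphic N1 N2 -> isomorphic N1' N2' ->
  exact_step K N2 N1' -> exact_step K N1 N2'.
Proof.
move=> iN iN' [G [f [g [KG fg fX]]]].
have [i [i' iK i'K]] := iN; have [j [j' jK j'K]] := iN'.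
have i'l : linear i' by move=> a x y; apply: (can_inj iK); rewrite linearP !i'K.
have [fI fgE gS] := fg.
exists G, (f \o i), (j \o g); split=> // [|X LX h]; first split=> [|y|y].
- exact: inj_comp fI (can_inj iK).
- split=> [/=|[x <-]]; last by rewrite /= (exact0 _ fgE) raddf0.
  rewrite -[X in _ = X](raddf0 j) => /(can_inj jK)/fgE[a <-].
  by exists (i' a); rewrite /= i'K.
- by have [x xE] := gS (j' y); exists x; rewrite /= xE j'K.
- have [k kE] := fX X LX (h \o lin i'l).
  by exists k => x; rewrite /= kE /= iK.
Qed.

(* M has a Hom(-,L)-exact coresolution by modules in K all of whose cosyzygies,
   M included, are orthogonal to L; the coresolution is encoded by the class W
   of its cosyzygies. *)
Definition coresolved K M :=
  exists2 W : module_class R, W M & forall N, W N -> ext_perp L N /\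
    exists (G N' : lmodType R) (f : {linear N -> G}) (g : {linear G -> N'}),
      [/\ K G, short_exact f g & W N'].

Lemma coresolved_perp K M : coresolved K M -> ext_perp L M.
Proof. by move=> [W WM /(_ M WM)[]]. Qed.

Lemma coresolved_step K M : coresolved K M ->
  exists (G N : lmodType R) (f : {linear M -> G}) (g : {linear G -> N}),
    [/\ K G, short_exact f g & coresolved K N].
Proof.
move=> [W WM WP]; have [_ [G [N [f [g [KG fg WN]]]]]] := WP M WM.
by exists G, N, f, g; split=> //; exists W.
Qed.

Lemma coresolved_cons K M N G (f : {linear M -> G}) (g : {linear G -> N}) :
    ext_perp L M -> K G -> short_exact f g -> coresolved K N ->
  coresolved K M.
Proof.
move=> Mp KG fg KN; exists (fun A => A = M \/ coresolved K A); first by left.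
move=> A [->|KA]; split=> //; first by exists G, N, f, g; split=> //; right.
  exact: coresolved_perp KA.
have [G' [N' [f' [g' [KG' fg' KN']]]]] := coresolved_step KA.
by exists G', N', f', g'; split=> //; right.
Qed.

Lemma coresolved_mono K K' M :
  (forall G, K G -> K' G) -> coresolved K M -> coresolved K' M.
Proof.
move=> KK' [W WM WP]; exists W => // A /WP[Ap [G [N [f [g [KG fg WN]]]]]].
by split=> //; exists G, N, f, g; split=> //; exact: KK'.
Qed.

Lemma coresolved_exact_step K M : coresolved K M ->
  exists N, coresolved K N /\ exact_step K M N.
Proof.
move=> /coresolved_step[G [N [f [g [KG fg KN]]]]].
exists N; split=> //; exists G, f, g; split=> // X LX.
exact: (ext_perp_ext1 (coresolved_perp KN)) LX _ _ _ _ fg.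
Qed.

Lemma coresolved_coresolution K M : coresolved K M -> coresolution L K M.
Proof.
move=> /dependent_choice/(_ (@coresolved_exact_step K))[z [<- zP]].
have [G [f [g fgP]]] := exact_step_choice zP.
have fg n : short_exact (f n) (g n) by case: (fgP n).
have fI n : injective (f n) by case: (fg n).
have gS n : surjective_map (g n) by case: (fg n).
(* At the left end nothing is spliced on, so the identity plays the part of the incoming
   surjection. *)
have idS : surjective_map (idfun : {linear z 0%N -> z 0%N}) by move=> x;
  exists x.
exists G, (f 0%N), (fun n => f n.+1 \o g n); split=> [n||X LX].
- by case: (fgP n).
- split=> // [|n]; last exact: splice_exact.
  exact: (splice_exact idS (fg 0%N) (fI 1%N)).
- have fX n : hom_surjective (f n) X by case: (fgP n) => _ _; apply.
  split=> // [|n]; last exact: splice_hom_exact.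
  exact: (splice_hom_exact idS (fg 0%N) (fX 1%N)).
Qed.

Lemma coresolution_tail K M : coresolution L K M ->
  exists N, coresolution L K N /\ exact_step K M N.
Proof.
move=> [G [e [d [KG [eI edE dE] GX]]]].
have [c cE] : exists c : {linear G 0%N -> kernel (d 1%N)},
    forall x, ker_inj (d 1%N) (c x) = d 0%N x.
  apply: factor_inj => [|x]; first exact: val_inj.
  by apply: kernel_lift; rewrite (exact0 _ (dE 0%N)).
have cS : surjective_map c.
  move=> y; have /dE[x xE] := kernelP y; exists x.
  by apply: val_inj; rewrite -[LHS]/(ker_inj (d 1%N) (c x)) cE.
have ec : exact e c.
  move=> y; rewrite -edE -cE; split=> [->|c0]; first exact: raddf0.
  by apply: val_inj; rewrite -[LHS]/(ker_inj (d 1%N) (c y)) c0 raddf0.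
exists (kernel (d 1%N)); split; last first.
  by exists (G 0%N), e, c; split=> // X /GX[].
exists (fun n => G n.+1), (ker_inj (d 1%N)), (fun n => d n.+1).
split=> // [|X LX].
  split=> // [|y]; first exact: val_inj.
  by split=> [/kernel_lift//|[x <-]]; exact: kernelP.
have [_ edX dX] := GX X LX; split=> // h.
  have /edX[k kE] : forall x, (h \o c) (e x) = 0.
    by move=> x; rewrite /= (exact0 _ ec) raddf0.
  by exists k => y; have [x <-] := cS y; rewrite cE kE.
split=> [h0|/dX h0 x]; last by have [y <-] := cS x; rewrite cE.
by apply/dX => x; rewrite -cE h0.
Qed.

(** Hom-exactness lets orthogonality pass from a cosyzygy and the term containing it to the next
    cosyzygy, so the invariant propagates to the right. *)
Lemma coresolution_coresolved K M : (forall G, K G -> ext_perp L G) ->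
  ext_perp L M -> coresolution L K M -> coresolved K M.
Proof.
move=> Kp Mp cM; exists (fun N => ext_perp L N /\ coresolution L K N) => //.
move=> N [Np /coresolution_tail[N' [cN' [G [f [g [KG fg fX]]]]]]].
split=> //; exists G, N', f, g; split=> //; split=> //.
exact: ext_perp_cokernel fg fX Np (Kp _ KG).
Qed.

Lemma exact_steps_complete_resolution K (z : int -> lmodType R) :
  (forall i, exact_step K (z i) (z (i - 1))) ->
    complete_resolution L K (z (-1)).
Proof.
move=> /exact_step_choice[G [f [g fgP]]].
have fg i : short_exact (f i) (g i) by case: (fgP i).
have fI i : injective (f i) by case: (fg i).
have gS i : surjective_map (g i) by case: (fg i).
exists G, (fun i => f (i - 1) \o g i); split=> [i|i|X LX i|].
- by case: (fgP i).
- exact: splice_exact.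
- have fX j : hom_surjective (f j) X by case: (fgP j) => _ _; apply.
  exact: splice_hom_exact.
(* The kernel of the spliced differential is the image of [f (-1)], a copy of [z (-1)]. *)
set d := (X in kernel X).
have dE x : d x = 0 <-> exists y, f (-1) y = x.
  have [_ fgE _] := fg (-1); rewrite -fgE /d /=.
  split=> [|->]; last exact: raddf0.
  by rewrite -[X in _ = X](raddf0 (f (-1 - 1))) => /fI.
have [u uE] : exists u : {linear z (-1) -> kernel d},
    forall x, ker_inj d (u x) = f (-1) x.
  apply: factor_inj => [|x]; first exact: val_inj.
  by apply/kernel_lift/dE; exists x.
have [v vE] : exists v : {linear kernel d -> z (-1)},
    forall x, f (-1) (v x) = ker_inj d x.
  by apply: factor_inj => // x; apply/dE; exact: kernelP.
exists u, v => x; first by apply: fI; rewrite vE uE.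
by apply: val_inj; rewrite -[LHS]/(ker_inj d (u (v x))) uE vE.
Qed.

(** This builds the left half: any projective presentation of an orthogonal module is Hom-exact, and
    its kernel is again orthogonal. *)
Lemma perp_exact_step M : ext_perp L M ->
  exists N, ext_perp L N /\ exact_step (@projective R) N M.
Proof.
move=> Mp; have [N [P [k [p [Pp kp]]]]] := free_presentation M.
exists N; split; first exact: ext_perp_syzygy Pp kp Mp.
exists P, k, p; split=> // X LX; exact: (ext_perp_ext1 Mp) LX _ _ _ _ kp.
Qed.

Lemma coresolved_complete_resolution K M : (forall P, projective P -> K P) ->
  coresolved K M -> complete_resolution L K M.
Proof.
move=> PK KM.
have [zr [zr0 zrS]] := dependent_choice KM (@coresolved_exact_step K).
have [zl [zl0 zlS]] :=
  dependent_choice (coresolved_perp KM) (@perp_exact_step).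
(* [Negz n] is [-(n+1)], so [M] sits at [-1] as [zr 0]; the left half, which also starts with [M],
   contributes from [zl 1] at position [0] on. *)
pose z (i : int) := match i with Posz n => zl n.+1 | Negz n => zr n end.
rewrite -zr0; apply: (@exact_steps_complete_resolution K z) => -[n|n];
  last first.
  have -> : Negz n - 1 = Negz n.+1; last exact: zrS.
  by apply: (congr1 (Negz \o S)); rewrite addn0.
have [G [f [g [/PK KG fg fX]]]] := zlS n.
have -> : z (Posz n - 1) = zl n.
  case: n {KG fg fX G f g} => [|n]; first by rewrite zl0 -zr0.
  by rewrite intS addrC addKr.
by exists G, f, g.
Qed.

Lemma complete_resolution_steps K M : complete_resolution L K M ->
  exists2 z : int -> lmodType R, isomorphic M (z (-1)) &
    forall i, exact_step K (z i) (z (i - 1)).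
Proof.
move=> [G [d [KG dE dX iM]]]; exists (fun i => kernel (d i)) => // i.
(* The argument uses the two preceding differentials; shifting the index by two makes their types
   match without casts. *)
have -> : i = i + 1 + 1 - 1 - 1 by rewrite !addrK.
move: (i + 1 + 1) => {}i.
have corestrict j : exists c : {linear G j -> kernel (d (j - 1))},
    surjective_map c /\ forall x, ker_inj (d (j - 1)) (c x) = d j x.
  have [|c cE] := @factor_inj _ _ _ _ (ker_inj (d (j - 1))) (d j) val_inj.
    by move=> x; apply: kernel_lift; rewrite (exact0 _ (dE j)).
  exists c; split=> // y; have /dE[x xE] := kernelP y; exists x.
  by apply: val_inj; rewrite -[LHS]/(ker_inj (d (j - 1)) (c x)) cE.
have [c [cS cE]] := corestrict (i - 1 - 1).
exists (G (i - 1 - 1)), (ker_inj _), c; split=> // [|X LX h].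
  split=> // [|y]; first exact: val_inj.
  rewrite -[c y = 0]/(c y = 0).
  have -> : c y = 0 <-> d (i - 1 - 1) y = 0.
    rewrite -cE; split=> [->|c0]; first exact: raddf0.
    by apply: val_inj; rewrite -[LHS]/(ker_inj _ (c y)) c0 raddf0.
  by split=> [/kernel_lift//|[x <-]]; exact: kernelP.
have [b [bS bE]] := corestrict (i - 1).
have [a [aS aE]] := corestrict i.
have /(dX X LX)[k kE] : forall x, (h \o b) (d i x) = 0.
  move=> x /=; have -> : b (d i x) = 0; last exact: raddf0.
  by apply: val_inj;
    rewrite -[LHS]/(ker_inj _ (b (d i x))) bE (exact0 _ (dE i)).
by exists k => x; have [y <-] := bS x; rewrite bE kE.
Qed.

Lemma complete_resolution_coresolved K M : (forall G, K G -> ext_perp L G) ->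
  complete_resolution L K M -> coresolved K M.
Proof.
move=> Kp /complete_resolution_steps[z iM zS].
(* All positions are treated at once: [z i] is the cokernel of [z (i + 1)] in a term of [K], so
   degree [n.+1] at [i] follows from degree [n] at [i + 1]. *)
have zp n i N : isomorphic N (z i) -> ext_perp_upto L n N.
  elim: n i N => // n IHn i N iN.
  have := zS (i + 1); rewrite addrK => zS1.
  have [G [f [g [KG fg fX]]]] :=
    exact_step_iso (isomorphic_refl _) (isomorphic_sym iN) zS1.
  have Gp := Kp _ KG.
  have N1 := ext1_perp_cokernel fg fX (ext_perp_ext1 Gp).
  exact: ext_perp_upto_cokernel fg N1 (IHn _ _ (isomorphic_refl _)) (Gp n.+1).
exists (fun N => exists i, isomorphic N (z i)); first by exists (-1).
move=> N [i iN]; split=> [n|]; first exact: zp iN.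
have [G [f [g [KG fg _]]]] := exact_step_iso iN (isomorphic_refl _) (zS i).
exists G, (z (i - 1)), f, g; split=> //.
by exists (i - 1); exact: isomorphic_refl.
Qed.

End Coresolved.

(** * Closure properties of Gorenstein projective modules *)

Section GorensteinProjective.
Variables (R : pzRingType) (L : module_class R).
Hypothesis projL : forall P : lmodType R, projective P -> L P.
Implicit Types A B C G M N P Q X : lmodType R.

Notation proj_coresolved := (coresolved L (@projective R)).

Lemma gorenstein_projectiveP M : gorenstein_projective L M <->
  proj_coresolved M.
Proof.
split; last exact: coresolved_complete_resolution.
exact/complete_resolution_coresolved/projective_ext_perp.
Qed.

Lemma projective_coresolved P : projective P -> proj_coresolved P.
Proof.
move=> Pp; exists (@projective R) => // {Pp}P Pp.
split; first exact: projective_ext_perp.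
exists (P * P)%type, P, (inl_map P P), (snd_map P P); split=> //.
  exact: projective_prod.
split=> [x y []//|[x y]|y]; last by exists (0, y).
by split=> [/= ->|[z [_ <-]]//]; exists x.
Qed.

Lemma extension_coresolved A B C (f : {linear A -> B}) (g : {linear B -> C}) :
  short_exact f g -> proj_coresolved A -> proj_coresolved C ->
    proj_coresolved B.
Proof.
move=> fg GA GC.
exists (fun B => exists A C (f : {linear A -> B}) (g : {linear B -> C}),
  [/\ short_exact f g, proj_coresolved A & proj_coresolved C]).
  by exists A, C, f, g.
move=> {A B C f g fg GA GC} B [A [C [f [g [fg GA GC]]]]].
have Cp := coresolved_perp GC.
split; first exact: ext_perp_extension fg (coresolved_perp GA) Cp.
have [P [A' [i [p [Pp ip GA']]]]] := coresolved_step GA.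
have [Q [C' [j [q [Qp jq GC']]]]] := coresolved_step GC.
(* Since [P] lies in [L], the embedding of [A] extends to [B]; paired with [j \o g] it embeds [B] in
   the product of [P] and [Q], and the cokernel is an extension of [C'] by [A']. *)
have [h hE] := ext_perp_ext1 Cp (projL Pp) fg i.
case: fg ip jq => fI fgE gS [iI ipE pS] [jI jqE qS].
pose k := pair_map h (j \o g).
have kI : injective k.
  apply: inj_ker0 => x [hx];
    rewrite -[X in _ = X -> _](raddf0 j) => /jI/fgE[a ax].
  by move: hx; rewrite -ax hE -[X in _ = X -> _](raddf0 i) => /iI->;
    rewrite raddf0.
pose c := [the {linear (P * Q)%type -> cokernel k} of coker_proj k].
have [_ cE cS] : short_exact k c by exact: coker_short_exact.
have [u uE] : exists u : {linear A' -> cokernel k},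
    forall x, u (p x) = c (inl_map P Q x).
  apply: (@factor_surj _ _ _ _ p (c \o inl_map P Q)) => // x /ipE[a <-].
  by apply/cE; exists (f a); congr (_, _);
    rewrite /= ?hE // (exact0 _ fgE) raddf0.
have [v vE] : exists v : {linear cokernel k -> C'}, forall x, v (c x) = q x.2.
  apply: (@factor_surj _ _ _ _ c (q \o snd_map P Q)) => // x /cE[b <-].
  by rewrite /= (exact0 _ jqE).
exists (P * Q)%type, (cokernel k), k, c; split.
- exact: projective_prod.
- exact: coker_short_exact.
exists A', C', u, v; split=> //; split=> [|t|y].
- apply: inj_ker0 => y; have [x <-] := pS y; rewrite uE => /cE[b [hb]].
  rewrite -[X in _ = X -> _](raddf0 j) => /jI/fgE[a ab].
  by rewrite -hb -ab hE (exact0 _ ipE).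
- have [[x y] <-] := cS t; rewrite vE /=; split=> [/jqE[b by_]|[s]].
    (* Subtracting [k b'] from [(x, y)] clears the second component without changing the class. *)
    have [b' b'E] := gS b; exists (p (x - h b')); rewrite uE.
    apply/eqP; rewrite -subr_eq0 -linearB; apply/eqP/cE; exists (- b').
    congr (_, _); rewrite /= raddfN ?b'E /=.
      by rewrite addrAC subrr add0r.
    by rewrite sub0r raddfN /= b'E by_.
  by have [x' <-] := pS s; rewrite uE => /(congr1 v); rewrite !vE /= raddf0.
- by have [x <-] := qS y; exists (c (0, x)); rewrite vE.
Qed.

(* Each cosyzygy N embeds in some G in GP with cokernel N', and G in a
   projective P; the cokernel H of N -> P is an extension of a module of GP by
   N', and pushing out along the next step shows that H is again such a
   cosyzygy. *)
Lemma coresolved_stable M :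
  coresolved L proj_coresolved M -> proj_coresolved M.
Proof.
move=> GM; exists (coresolved L proj_coresolved) => // {GM}M GM.
split; first exact: coresolved_perp GM.
have [G [N [f [g [GG fg GN]]]]] := coresolved_step GM.
have [P [G' [i [p [Pp ip GG']]]]] := coresolved_step GG.
have [H [h [u [v [fh uv]]]]] := cokernel_of_comp fg ip.
exists P, H, (i \o f), h; split=> //.
have Hp := ext_perp_extension uv (coresolved_perp GN) (coresolved_perp GG').
have [G2 [N' [f2 [g2 [GG2 fg2 GN']]]]] := coresolved_step GN.
have [T [a [b [a' [b' [ab ab']]]]]] := pushout uv fg2.
exact: coresolved_cons Hp (extension_coresolved ab' GG2 GG') ab GN'.
Qed.

Lemma coresolved_kernel P G M (f : {linear M -> P}) (g : {linear P -> G}) :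
  projective P -> proj_coresolved G -> short_exact f g -> proj_coresolved M.
Proof.
move=> Pp GG fg.
have Mp := ext_perp_kernel fg (projective_ext_perp L Pp) (coresolved_perp GG).
exact: coresolved_cons Mp Pp fg GG.
Qed.

Lemma coresolved_cokernel G1 G0 M (f : {linear G1 -> G0})
  (g : {linear G0 -> M}) :
    proj_coresolved G1 -> proj_coresolved G0 -> short_exact f g ->
  ext1_perp L M -> proj_coresolved M.
Proof.
move=> GG1 GG0 fg M1.
have [P [G' [i [p [Pp ip GG']]]]] := coresolved_step GG1.
have [Q [v [q [u [r [vq ur]]]]]] := pushout fg ip.
have GQ := extension_coresolved vq GG0 GG'.
(* Extending the identity of [P], a module of [L], gives a retraction of [u], so [P -> Q -> M]
   splits. *)
have [t tE] := M1 P (projL Pp) _ _ _ _ ur idfun.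
have [uI urE rS] := ur.
have [s sE] : exists s : {linear M -> Q}, forall x, s (r x) = x - u (t x).
  apply: (@factor_surj _ _ _ _ r (idfun \- (u \o t))) => // x /urE[y <-].
  by rewrite /= tE subrr.
have rs x : r (s x) = x.
  by have [y <-] := rS x; rewrite sE linearB /= (exact0 _ urE) subr0.
have su : short_exact s t.
  split=> [x y /(congr1 r)|x|y]; first by rewrite !rs.
    split=> [tx|[y <-]]; first by exists (r x); rewrite sE tx raddf0 subr0.
    by have [z <-] := rS y; rewrite sE linearB /= tE subrr.
  by exists (u y); exact: tE.
(* The summand [M] of [Q] embeds in the projective [P'], and the cokernel is an extension of [G'']
   by the complement [P]. *)
have [P' [G'' [j [q' [P'p jq' GG'']]]]] := coresolved_step GQ.
have [H [h [a [b [sh ab]]]]] := cokernel_of_comp su jq'.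
exact: coresolved_kernel P'p
  (extension_coresolved ab (projective_coresolved Pp) GG'') sh.
Qed.

End GorensteinProjective.

(** * Projective modules belong to the class *)

Lemma free_module_coproduct (R : pzRingType) (I : choiceType) :
  exists inj : forall i : I, {linear R^o -> free_module R I}, coproduct_of inj.
Proof.
have il (i : I) : linear (fun r : R^o => (r : R) *: free_delta R i).
  by move=> a x y; rewrite scalerDl scalerA.
exists (fun i => lin (il i)) => N f; split=> [|h h' hE h'E].
  exists (free_lift (fun i => f i 1)) => i x /=.
  rewrite linearZ /= free_lift_delta -linearZ; congr (f i _); exact: mulr1.
apply: free_ext => i; have := hE i 1; have := h'E i 1.
by rewrite /= scale1r => -> ->.
Qed.

(** The free cover of [P] splits, which exhibits [P] as a summand of a coproduct of copies of
    [R]. *)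
Lemma projective_mem (R : pzRingType) (L : module_class R) :
    L R^o -> coproduct_closed L -> summand_closed L ->
  forall P, projective P -> L P.
Proof.
move=> LR Lcop Lsum P Pp.
have kp := kernel_short_exact (@free_cover_surjective R P).
have [s sE] := projective_split Pp kp.
have [inj injC] := free_module_coproduct R P.
apply: Lsum (Lcop _ _ _ _ injC (fun=> LR)).
by exists (kernel (free_cover P)); exact: split_isomorphic kp sE.
Qed.

(** * The cycle of implications *)

Theorem proposition3p1 (R : pzRingType) (L : module_class R)
    (A : module_class R^c) (LA : complete_duality_pair L A) (M : lmodType R) :
  [<-> (* 1 *) gorenstein_projective L M;
       (* 2 *) coresolution L (@projective R) M /\
         (forall X i, L X -> (1 <= i)%N -> Ext_eq0 i M X);
       (* 3 *) exists (P G : lmodType R) (f : {linear M -> P})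
           (g : {linear P -> G}),
         [/\ projective P, gorenstein_projective L G & short_exact f g];
       (* 4 *) (exists (G1 G0 : lmodType R) (f : {linear G1 -> G0})
           (g : {linear G0 -> M}),
         [/\ gorenstein_projective L G1, gorenstein_projective L G0
           & short_exact f g]) /\
         (forall X, L X -> Ext_eq0 1 M X);
       (* 5 *) coresolution L (gorenstein_projective L) M /\
         (forall X i, L X -> (1 <= i)%N -> Ext_eq0 i M X);
       (* 6 *) complete_resolution L (gorenstein_projective L) M;
       (* 7 *) exists U : module_class R,
         [/\ iso_closed U,
             forall N, projective N -> U N,
             forall N, U N -> gorenstein_projective L N,
             coresolution L U M
           & forall X i, L X -> (1 <= i)%N -> Ext_eq0 i M X];
       (* 8 *) exists U : module_class R,
         [/\ iso_closed U,
             forall N, projective N -> U N,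
             forall N, U N -> gorenstein_projective L N
           & complete_resolution L U M]].

Proof.
(* Perfectness supplies [R] and coproducts; closure of [L] under summands comes from the reversed
   duality pair. *)
have [[_ LR Lcop _] [_ _ Lsum _]] := LA.
have projL := projective_mem LR Lcop Lsum.
have GPE := gorenstein_projectiveP L.
have projG P : projective P -> gorenstein_projective L P.
  by move=> /(projective_coresolved L)/GPE.
have GPp G : gorenstein_projective L G -> ext_perp L G.
  by move=> /GPE/coresolved_perp.
have GP2 N : gorenstein_projective L N -> coresolution L (@projective R) N /\
    (forall X i, L X -> (1 <= i)%N -> Ext_eq0 i N X).
  move=> /GPE GN; split; first exact: coresolved_coresolution.
  exact/ext_perpP/(coresolved_perp GN).
have stable N : coresolved L (gorenstein_projective L) N ->
    gorenstein_projective L N.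
  move=> GN; apply/GPE/(coresolved_stable projL).
  by apply: coresolved_mono GN => G /GPE.
tfae.
- exact: GP2.
- move=> [cM /ext_perpP Mp].
  have GM := coresolution_coresolved (@projective_ext_perp R L) Mp cM.
  have [P [G [f [g [Pp fg /GPE GG]]]]] := coresolved_step GM.
  by exists P, G, f, g.
- move=> [P [G [f [g [Pp /GPE GG fg]]]]].
  have GM := coresolved_kernel Pp GG fg.
  have Mp := coresolved_perp GM.
  split; last exact/ext1_perpP/(ext_perp_ext1 Mp).
  (* A free presentation of [M] serves: its kernel is Gorenstein projective because [M] already
     is. *)
  have [K [Q [k [q [Qp kq]]]]] := free_presentation M.
  exists K, Q, k, q; split=> //; last exact: projG.
  exact/GPE/(coresolved_kernel Qp GM kq).
- move=> [[G1 [G0 [f [g [/GPE GG1 /GPE GG0 fg]]]]] /ext1_perpP M1].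
  have GM := coresolved_cokernel projL GG1 GG0 fg M1.
  split; last exact/ext_perpP/(coresolved_perp GM).
  exact/coresolved_coresolution/(coresolved_mono projG GM).
- move=> [cM /ext_perpP Mp].
  apply: coresolved_complete_resolution => //.
  exact: coresolution_coresolved.
- move=> /(complete_resolution_coresolved GPp)/stable/GP2[cM Mp].
  exists (@projective R); split=> //; exact: projective_iso_closed.
- move=> [U [Uiso PU UG cM /ext_perpP Mp]]; exists U; split=> //.
  apply: coresolved_complete_resolution => //.
  by apply: coresolution_coresolved => // G /UG/GPp.
(* The right half is a coresolution by Gorenstein projectives with orthogonal cosyzygies, and
   stability applies. *)
- move=> [U [_ _ UG]] /complete_resolution_coresolved UM; apply: stable.
  by apply: (coresolved_mono UG); apply: UM => G /UG/GPp.
Qed.
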